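(* The two following properties hold: (i) For all $x\in E$, the $\sigma$-finite measure $\mathbb Q_x^{(r)}$ does not depend on $r\in(0,1)$. (ii) Let $\mathbb Q_x$ denote the measure equal to $\mathbb Q_x^{(r)}$ for all $r\in(0,1)$, and let $F_n\ge0$ be an $\mathcal F_n$-measurable functional. If $q:E\to[0,1]$ is a function such that $\{q<1\}$ is a finite set, then $$\mathbb Q_x\left[F_n\prod_{k=0}^\infty q(X_k)\right]=\mathbb E_x\left[F_n\,\psi_q(X_n)\prod_{k=0}^{n-1}q(X_k)\right],$$ where, for $y\in E$, $\displaystyle\psi_q(y)=\mathbb Q_y\left[\prod_{k=0}^\infty q(X_k)\right]$.
   Context: $E$ is a countable set, $(X_n)_{n\ge0}$ the canonical process on $E^{\mathbb N}$, $\mathcal F_n=\sigma(X_0,\dots,X_n)$, $\mathcal F_\infty=\sigma(X_n,n\ge0)$. $(\mathbb P_x)_{x\in E}$ are the laws (expectations $\mathbb E_x$) of a time-homogeneous Markov chain with transition probabilities $(p_{y,z})$, $\mathbb P_x(X_0=x)=1$. Assumptions: for every $x$, $\{y:p_{x,y}>0\}$ is finite; for all $x,y$ there is $n\in\mathbb N$ with $\mathbb P_x(X_n=y)>0$; for every $x$ the canonical process is recurrent under $\mathbb P_x$. Fix $x_0\in E$ and $\phi:E\to\mathbb R_+$ such that $\phi(x_0)=0$, $\mathbb E_x[\phi(X_1)]=\phi(x)$ for all $x\ne x_0$, and $\phi$ is unbounded. For $r\in(0,1)$ let $\psi_r(x)=\frac r{1-r}\mathbb E_{x_0}[\phi(X_1)]+\phi(x)$.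 For $y\in E$, $L_k^y=\sum_{m=0}^k1_{X_m=y}$ $(k\ge0)$, $L_{-1}^y=0$, $L_\infty^y=\lim_kL_k^y$. Then $(\psi_r(X_n)r^{L_{n-1}^{x_0}})_{n\ge0}$ is a $\mathbb P_x$-martingale, and $\mu_x^{(r)}$ denotes the finite measure on $(E^{\mathbb N},\mathcal F_\infty)$ with $\mu_x^{(r)}|_{\mathcal F_n}=\psi_r(X_n)r^{L_{n-1}^{x_0}}\cdot\mathbb P_x|_{\mathcal F_n}$ for all $n$. One has $L_\infty^{x_0}<\infty$ $\mu_x^{(r)}$-a.s., and $$\mathbb Q_x^{(r)}=\left(\frac1r\right)^{L_\infty^{x_0}}\cdot\mu_x^{(r)}.$$ *)

(* Defs.v *)
(* MathComp-Analysis, over an arbitrary [R : realType]. *)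
From HB Require Import structures.
From mathcomp Require Import all_boot all_order all_algebra.
From mathcomp Require Import all_classical all_reals all_analysis measurable_realfun.

Set Implicit Arguments.
Unset Strict Implicit.
Unset Printing Implicit Defensive.

Import Order.TTheory GRing.Theory Num.Theory.
Import numFieldNormedType.Exports.

Local Open Scope classical_set_scope.
Local Open Scope ring_scope.

Section trajectories.
Variable E : pointedType.
Implicit Types (w : nat -> E) (y : E).

(* The canonical process is X_n(w) = w n. The countable set E carries the
   discrete sigma-algebra, so sigma(X_k) consists of the preimages of all
   subsets of E under w |-> w k. *)
Definition sigma_coord (k : nat) : set (set (nat -> E)) :=
  preimage_set_system [set: nat -> E] (fun w => w k) discrete_measurable.

(* F_n = sigma(X_0, ..., X_n) *)
Definition past (n : nat) : set (set (nat -> E)) :=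
  <<s \bigcup_(k in [set k | (k <= n)%N]) sigma_coord k >>.

(* E^N equipped with F_oo = sigma(X_k, k >= 0) *)
Definition traj := g_sigma_algebraType (\bigcup_k sigma_coord k).

(* Number of visits to y strictly before time n: this is L_{n-1}^y, so the
   value 0 at n = 0 is the convention L_{-1}^y = 0. *)
Definition visits y (n : nat) w : nat := \sum_(m < n) (w m == y).

Definition total_visits (R : realType) y w : \bar R :=
  limn (fun n => ((visits y n w)%:R)%:E).

End trajectories.

Section markov_chain.
Context {R : realType} {E : pointedType}.

Definition stochastic (p : E -> E -> R) : Prop :=
  (forall y z, 0 <= p y z) /\
  (forall y, (\esum_(z in [set: E]) (p y z)%:E = 1)%E).

(* The last clause is P_x(X_{n+1} = z | F_n) = p(X_n, z) P_x-a.s., with the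
   conditional probability written out on the events of F_n. *)
Definition markov_laws (p : E -> E -> R)
    (P : E -> probability (traj E) R) : Prop :=
  (forall x, P x [set w : traj E | w 0%N = x] = 1%E) /\
  (forall x n z (A : set (traj E)), past n A ->
     P x (A `&` [set w : traj E | w n.+1 = z]) =
     (\int[P x]_(w in A) (p (w n) z)%:E)%E).

Definition irreducible (P : E -> probability (traj E) R) : Prop :=
  forall x y, exists n, (0 < P x [set w : traj E | w n = y])%E.

(* P_x(X_n = x for infinitely many n) = 1 for every x *)
Definition recurrent (P : E -> probability (traj E) R) : Prop :=
  forall x, P x (lim_sup_set (fun n => [set w : traj E | w n = x])) = 1%E.

(* Under the standing hypotheses (finitely many successors of x0) the
   expectation is finite, so [fine] loses nothing. *)
Definition psi (P : E -> probability (traj E) R) (phi : E -> R) (x0 : E)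
    (r : R) (x : E) : R :=
  r / (1 - r) * fine ('E_(P x0)[fun w : traj E => phi (w 1%N)])%E + phi x.

(* mu restricted to F_n is psi_r(X_n) r^{L_{n-1}^{x0}} . P_x, for all n *)
Definition is_penalised (P : E -> probability (traj E) R) (phi : E -> R)
    (x0 : E) (r : R) (x : E) (mu : set (traj E) -> \bar R) : Prop :=
  forall n (A : set (traj E)), past n A ->
    mu A = (\int[P x]_(w in A)
              (psi P phi x0 r (w n) * r ^+ visits x0 n w)%:E)%E.

(* prod_{k >= 0} q(X_k) *)
Definition infinite_prod (q : E -> R) (w : nat -> E) : R :=
  limn (fun n => \prod_(k < n) q (w k)).

(* psi_q(y) = Q_y[prod_{k >= 0} q(X_k)], possibly infinite *)
Definition psi_q (Q : E -> {measure set (traj E) -> \bar R}) (q : E -> R)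
    (y : E) : \bar R :=
  (\int[Q y]_w (infinite_prod q w)%:E)%E.

End markov_chain.

(* a^l for an exponent l in [0, +oo] and a > 1, with a^oo = +oo; the value at
   -oo is a dummy. *)
Definition epow {R : realType} (a : R) (l : \bar R) : \bar R :=
  match l with
  | l%:E => (a `^ l)%:E
  | +oo => +oo
  | -oo => 0
  end%E.

Section weighted_measure.
Context {R : realType} {E : pointedType}.

Lemma measurable_sigma_coord k (B : set E) :
  measurable ((fun w : traj E => w k) @^-1` B).
Proof.
by apply: sub_sigma_algebra; exists k => //; exists B => //; rewrite setTI.
Qed.

Lemma measurable_visits (y : E) n :
  measurable_fun [set: traj E] (fun w => (visits y n w)%:R : R).
Proof.
have -> : (fun w : traj E => (visits y n w)%:R : R) =
    (fun w => \sum_(m < n) \1_((fun w : traj E => w m) @^-1` [set y]) w).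
  apply/funext => w; rewrite /visits natr_sum; apply: eq_bigr => m _.
  by rewrite indicE; congr (nat_of_bool _)%:R; apply/eqP/idP; rewrite inE.
apply: measurable_sum => m.
by apply: measurable_indic; exact: measurable_sigma_coord.
Qed.

Lemma cvg_visits (y : E) (w : nat -> E) :
  (fun n => ((visits y n w)%:R)%:E : \bar R) @ \oo --> total_visits R y w.
Proof.
apply: ereal_nondecreasing_is_cvgn => m n mn.
rewrite lee_fin ler_nat /visits -!(big_mkord xpredT (fun k => w k == y : nat)).
by rewrite (big_cat_nat (leq0n m) mn)/= leq_addr.
Qed.

Lemma measurable_total_visits (y : E) :
  measurable_fun [set: traj E] (total_visits R y).
Proof.
apply: (emeasurable_fun_cvg
  (fun n (w : traj E) => ((visits y n w)%:R)%:E)) => [n|w _].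
  by apply/measurable_EFinP; exact: measurable_visits.
exact: cvg_visits.
Qed.

Lemma epow_ge0 (a : R) l : (0 <= epow a l)%E.
Proof. by case: l => [l| |]//=; rewrite lee_fin powR_ge0. Qed.

Lemma measurable_epow (a : R) : measurable_fun [set: \bar R] (epow a).
Proof.
rewrite (_ : epow a = fun l => if l == +oo%E then +oo%E else
    if l == -oo%E then 0%E else ((powR a \o fine) l)%:E); last first.
  by apply/funext; case.
have mE (c : \bar R) : measurable_fun [set: \bar R] (fun l => l == c).
  apply: (measurable_fun_bool true) => //.
  rewrite setTI (_ : _ @^-1` _ = [set c]); first exact: emeasurable_set1.
  by apply/seteqP; split => l /= /eqP.
apply: measurable_fun_ifT => //; apply: measurable_fun_ifT => //.
apply/measurable_EFinP; apply: measurableT_comp.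
  exact: measurable_powRr.
exact: fine_measurable.
Qed.

(* Q^(r) = (1/r)^{L_oo^{x0}} . mu *)
Definition weighted (x0 : E) (r : R) (mu : {measure set (traj E) -> \bar R})
    (A : set (traj E)) : \bar R :=
  (\int[mu]_(w in A) epow r^-1 (total_visits R x0 w))%E.

Section instance.
Variables (x0 : E) (r : R) (mu : {measure set (traj E) -> \bar R}).

Let weighted0 : weighted x0 r mu set0 = 0%E.
Proof. exact: integral_set0. Qed.

Let weighted_ge0 A : (0 <= weighted x0 r mu A)%E.
Proof. by apply: integral_ge0 => w _; exact: epow_ge0. Qed.

Let weighted_sigma_additive : semi_sigma_additive (weighted x0 r mu).
Proof.
apply: semi_sigma_additive_nng_induced => [|w]; last exact: epow_ge0.
apply: measurableT_comp; first exact: measurable_epow.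
exact: measurable_total_visits.
Qed.

HB.instance Definition _ := isMeasure.Build _ _ _ (weighted x0 r mu)
  weighted0 weighted_ge0 weighted_sigma_additive.
End instance.

End weighted_measure.

(* Main.v *)
Require Import Defs.
From HB Require Import structures.
From mathcomp Require Import all_boot all_order all_algebra.
From mathcomp Require Import all_classical all_reals all_analysis measurable_realfun.
From mathcomp Require Import ring.

Set Implicit Arguments.
Unset Strict Implicit.
Unset Printing Implicit Defensive.

Import Order.TTheory GRing.Theory Num.Theory.
Import numFieldNormedType.Exports.

Local Open Scope classical_set_scope.
Local Open Scope ring_scope.

(** Both parts rest on the decomposition of a trajectory at its last visit to
    [x0].  Write [c + phi] for [psi_r], where [c] does not depend on the
    position; [avoids_from x0 n] is the event that [x0] is not visited at any
    time [>= n].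

    Part (i).  If [A] depends on [X_0, ..., X_n], the density of [mu] at time
    [N >= n] gives the mass of the part of [A] on which [x0] is avoided during
    [[n, N)].  On that event the number of visits is frozen at its value at
    time [n], so the mass is
      [c E[r^visits; A, no visit in [n, N)]
         + E[phi(X_N) r^visits; A, no visit in [n, N)]].
    The chain is recurrent, so the first term vanishes as [N] grows.  The second
    does not depend on [N]: up to its next visit to [x0], where [phi] vanishes,
    [phi(X_N)] is a martingale, a fact already contained in the agreement of the
    densities of [mu] at times [N] and [N + 1].  Hence [mu] gives to the part of
    [A] in [avoids_from x0 n] the mass [E[phi(X_n) r^visits; A]]
    ([penalised_late]).  There the weight of the total number of visits cancels
    [r^visits] exactly, so [weighted x0 r mu] gives to the part of a cylinder of
    length [n] in [avoids_from x0 n] the mass [phi(X_n) P_x(cylinder)], free of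
    [r] ([weighted_cylinder_late]).  Cylinders of length at least [n] generate
    the sigma-algebra, so the traces on [avoids_from x0 n] agree for all [r].
    What remains is the event of infinitely many visits to [x0].  By
    [penalised_late] and the formula for the total mass, the complement of
    [avoids_from x0 n] has [mu]-mass [c E[r^visits before n]], which tends to [0]
    because the chain itself visits [x0] infinitely often; so the remaining event
    is null ([penalised_io_null]).  This yields sigma-finiteness as well.

    Part (ii) is a Markov property of [Q].  On a cylinder of length [n] ending
    at [y], the density of [mu_x] is [r^visits] times the density of [mu_y] for
    the shifted trajectory, and the weight factorises in the inverse way; so
    [Q_x] of the cylinder intersected with a shifted event [B] is
    [P_x(cylinder) Q_y(B)] ([weighted_markov]).  Both sides of (ii) are sums over
    the countably many cylinders of length [n], on each of which [F] and the
    first [n] factors of the product are constant. *)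

(** * Events depending on finitely many coordinates *)

Section cylinders.
Context {E : pointedType}.
Implicit Types (w : traj E) (D : set (traj E)).

Definition cylinder n w : set (traj E) :=
  [set w' | forall k, (k <= n)%N -> w' k = w k].

Definition determined n D := forall w w', cylinder n w w' -> D w -> D w'.

Lemma cylinder_sym n w w' : cylinder n w w' -> cylinder n w' w.
Proof. by move=> ww' k kn; rewrite ww'. Qed.

Lemma cylinder_trans n w w' w'' :
  cylinder n w w' -> cylinder n w' w'' -> cylinder n w w''.
Proof. by move=> ww' w'w'' k kn; rewrite w'w''// ww'. Qed.

Lemma cylinder_le m n w w' : (m <= n)%N -> cylinder n w w' -> cylinder m w w'.
Proof. by move=> mn ww' k km; rewrite ww'// (leq_trans km). Qed.

Lemma determined_le m n D : (m <= n)%N -> determined m D -> determined n D.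
Proof. by move=> mn dD w w' /(cylinder_le mn); exact: dD. Qed.

Lemma determinedI n A B :
  determined n A -> determined n B -> determined n (A `&` B).
Proof.
by move=> dA dB w w' ww' [/dA Aw /dB Bw]; split; [exact: Aw|exact: Bw].
Qed.

Lemma determined_cylinder n w : determined n (cylinder n w).
Proof. by move=> w1 w2 w12 /cylinder_trans; exact. Qed.

Lemma past_sigma_algebra n : sigma_algebra setT (@past E n).
Proof. exact: smallest_sigma_algebra. Qed.

Lemma past_coord n k (B : set E) :
  (k <= n)%N -> past n ((fun w : traj E => w k) @^-1` B).
Proof.
move=> kn; apply: sub_sigma_algebra; exists k => //.
by exists B => //; rewrite setTI.
Qed.

Lemma past_measurable n D : past n D -> measurable D.
Proof.
apply: smallest_sub; first exact: smallest_sigma_algebra.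
by move=> A [k _ kA]; apply: sub_sigma_algebra; exists k.
Qed.

Lemma past_determined n D : past n D -> determined n D.
Proof.
suff : @past E n `<=` determined n by exact.
apply: smallest_sub.
  split=> //.
  - by move=> A dA w w' ww' [_ nAw]; split=> // Aw'; apply: nAw;
      exact: dA (cylinder_sym ww') Aw'.
  - by move=> F dF w w' ww' [i _ Fw]; exists i => //; exact: dF ww' Fw.
move=> A [k /= kn [B _ <-]] w w' ww' [_ Bw]; split=> //.
by rewrite /preimage /= ww'.
Qed.

Lemma past_cylinder n w : past n (cylinder n w).
Proof.
have -> : cylinder n w = \bigcap_k (if (k <= n)%N then
    (fun w' : traj E => w' k) @^-1` [set w k] else setT).
  apply/seteqP; split=> [w' ww' k _|w' ww' k kn].
    by case: ifPn => // kn; exact: ww'.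
  by have := ww' k Logic.I; rewrite kn.
apply: (@bigcapT_measurable _ (g_sigma_algebraType
  (\bigcup_(k in [set k | (k <= n)%N]) @sigma_coord E k))) => k.
case: ifPn => [kn|_]; first exact: past_coord.
exact: (@measurableT _ (g_sigma_algebraType
  (\bigcup_(k in [set k | (k <= n)%N]) @sigma_coord E k))).
Qed.

Hypothesis E_countable : countable [set: E].

(** Cylinders of a fixed length are the level sets of a map into [nat]: this
    gives a countable partition indexed by [nat], in which some blocks may be
    empty. *)
Lemma cylinder_index n : exists c : traj E -> nat,
  forall w w', c w = c w' <-> cylinder n w w'.
Proof.
have /countable_injP[f finj] := E_countable.
exists (fun w => CodeSeq.code (mkseq (f \o w) n.+1)) => w w'; split.
- move/(can_inj CodeSeq.codeK) => ww' k kn.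
  have := congr1 (fun s => nth 0%N s k) ww'.
  by rewrite !nth_mkseq// => /finj ->//; rewrite inE.
- move=> ww'; congr CodeSeq.code; apply: (@eq_from_nth _ 0%N).
    by rewrite !size_mkseq.
  by move=> k; rewrite size_mkseq => kn; rewrite !nth_mkseq//= ww'.
Qed.

(** Countability of [E] makes [past n] an atomic sigma-algebra whose atoms are
    cylinders, so membership can be tested pointwise. *)
Lemma determined_past n D : determined n D -> past n D.
Proof.
have [c cP] := cylinder_index n => dD.
have -> : D = \bigcup_j ([set w | c w = j] `&` D).
  by apply/seteqP; split=> [w Dw|w [j _ []]//]; exists (c w).
have [p0 _ pU] := past_sigma_algebra n; apply: pU => j.
have [->|/set0P[w [/= cw Dw]]] := eqVneq ([set w | c w = j] `&` D) set0.
  exact: p0.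
rewrite [X in past n X](_ : _ = cylinder n w); first exact: past_cylinder.
apply/seteqP; split=> [w' [/= cw' _]|w' ww'].
  by apply/cP; rewrite cw.
by split=> /=; [rewrite -cw; apply/esym/cP|exact: dD ww' Dw].
Qed.

Lemma determined_measurable n D : determined n D -> measurable D.
Proof. by move=> dD; apply: past_measurable; exact: determined_past dD. Qed.

Lemma determined_measurable_fun d (T : sigmaRingType d) n (f : traj E -> T) :
  (forall w w', cylinder n w w' -> f w' = f w) -> measurable_fun setT f.
Proof.
move=> fE _ B mB; rewrite setTI.
apply: (@determined_measurable n) => w w' ww'.
by rewrite /preimage/= (fE _ _ ww').
Qed.

End cylinders.

(** * Shifting time *)

Section shift.
Context {E : pointedType}.
Implicit Types w : traj E.

(** The shift operator usually written theta_n. *)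
Definition time_shift n w : traj E := fun k => w (n + k)%N.

Lemma measurable_shift n : measurable_fun setT (time_shift n).
Proof.
apply: measurability => // _ [_ [k _ [B _ <-]] <-].
by rewrite !setTI; exact: (measurable_sigma_coord (n + k) B).
Qed.

Lemma cylinder_shift n m w w' :
  cylinder (n + m) w w' -> cylinder m (time_shift n w) (time_shift n w').
Proof. by move=> ww' k km; rewrite /time_shift ww'// leq_add2l. Qed.

Lemma determined_shift n m A :
  determined m A -> determined (n + m) (@time_shift n @^-1` A).
Proof. by move=> dA w w' /cylinder_shift; exact: dA. Qed.

Lemma visits_shift y n m w :
  visits y (n + m) w = (visits y n w + visits y m (time_shift n w))%N.
Proof. by rewrite /visits big_split_ord. Qed.

Lemma visits_cylinder y n m w w' :
  (n <= m.+1)%N -> cylinder m w w' -> visits y n w' = visits y n w.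
Proof.
move=> nm ww'; apply: eq_bigr => k _; rewrite ww'//.
by rewrite -ltnS (leq_trans _ nm).
Qed.

Lemma total_visits_shift (R : realType) y n w :
  total_visits R y w =
  (((visits y n w)%:R)%:E + total_visits R y (time_shift n w))%E.
Proof.
apply/cvg_lim => //.
rewrite -(cvg_shiftn n).
under eq_fun do rewrite addnC visits_shift natrD EFinD.
by apply: cvgeD; [exact: fin_num_adde_defr|exact: cvg_cst|exact: cvg_visits].
Qed.

End shift.

(** * The last visit to a point *)

Section last_visit.
Context {E : pointedType}.
Variable x0 : E.
Implicit Types w : traj E.

Definition avoids n N : set (traj E) :=
  [set w | forall k, (n <= k < N)%N -> w k <> x0].

Definition avoids_from n : set (traj E) :=
  [set w | forall k, (n <= k)%N -> w k <> x0].

Lemma determined_avoids n N M : (N <= M.+1)%N -> determined M (avoids n N).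
Proof.
move=> NM w w' ww' aw k /andP[nk kN].
by rewrite ww' -1?ltnS ?(leq_trans kN)//; apply: aw; rewrite nk.
Qed.

Lemma avoids_from_bigcap n : avoids_from n = \bigcap_N avoids n (n + N).
Proof.
apply/seteqP; split=> [w aw N _ k /andP[nk _]|w aw k nk]; first exact: aw.
by apply: (aw k.+1 Logic.I); rewrite nk addnS ltnS leq_addl.
Qed.

Lemma shift_avoids_from n k :
  @time_shift E n @^-1` (avoids_from k) = avoids_from (n + k).
Proof.
apply/seteqP; split=> w aw j.
  by move=> nkj; rewrite -(@subnKC n j) ?(leq_trans (leq_addr _ _) nkj)//;
    apply: aw; rewrite leq_subRL// (leq_trans (leq_addr _ _) nkj).
by move=> kj; apply: aw; rewrite leq_add2l.
Qed.

Lemma avoids_from_le m n : (m <= n)%N -> avoids_from m `<=` avoids_from n.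
Proof. by move=> mn w aw k nk; apply: aw; exact: leq_trans nk. Qed.

(** The visit count is frozen while [x0] is avoided, which is what lets the
    factor [r ^+ visits] be read off at time [n] instead of [N]. *)
Lemma visits_avoids n N w : (n <= N)%N -> avoids n N w ->
  visits x0 N w = visits x0 n w.
Proof.
move=> nN aw; rewrite -(subnKC nN) visits_shift.
rewrite [X in (_ + X)%N]big1 ?addn0// => k _; apply/eqP; rewrite eqb0.
apply/eqP; apply: aw; rewrite leq_addr/=.
by rewrite -ltn_subRL.
Qed.

Lemma total_visits_avoids_from (R : realType) n w :
  avoids_from n w -> total_visits R x0 w = ((visits x0 n w)%:R)%:E.
Proof.
move=> aw; apply/cvg_lim => //; rewrite -(cvg_shiftn n).
rewrite (_ : (fun _ => _) = cst ((visits x0 n w)%:R)%:E); first exact: cvg_cst.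
apply/funext => k /=; rewrite (@visits_avoids n) ?leq_addl// => j /andP[nj _].
exact: aw.
Qed.

Lemma measurable_avoids_from (E_countable : countable [set: E]) n :
  measurable (avoids_from n).
Proof.
rewrite avoids_from_bigcap; apply: bigcapT_measurable => N.
exact: (determined_measurable E_countable (determined_avoids (leqnSn _))).
Qed.

(** A cylinder of length [k >= n] already decides whether [x0] is visited
    between [n] and [k]. *)
Lemma cylinder_avoids_from n k (w : traj E) : (n <= k)%N ->
  cylinder k w `&` avoids_from n = cylinder k w `&` avoids_from k \/
  cylinder k w `&` avoids_from n = set0.
Proof.
move=> nk; have [aw|naw] := pselect (avoids n k w); [left|right].
  apply/seteqP; split=> w' [ww' aw']; split=> //.
    exact: avoids_from_le aw'.
  move=> j nj; have [jk|kj] := ltnP j k; last exact: aw'.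
  by rewrite ww' ?(ltnW jk)//; apply: aw; rewrite nj.
apply/seteqP; split=> // w' [ww' aw']; apply: naw => j /andP[nj jk].
by rewrite -ww' ?(ltnW jk)//; exact: aw'.
Qed.

Lemma cvg_visits_pinfty (w : traj E) :
  (forall n, ~ avoids_from n w) -> visits x0 n w @[n --> \oo] --> \oo.
Proof.
move=> io; apply/cvgnyPge => K.
suff [n nK] : exists n, (K <= visits x0 n w)%N.
  exists n => // k /= nk; rewrite (leq_trans nK)//.
  by rewrite -(subnKC nk) visits_shift leq_addr.
elim: K => [|K [n nK]]; first by exists 0%N.
have [k nkx0] := (existsNP _).2 (io n).
have [nk wk] : (n <= k)%N /\ w k = x0.
  by have [nk /contrapT] := (not_implyP _ _).1 nkx0.
exists k.+1; rewrite -(addn1 k) visits_shift.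
rewrite [X in (_ + X)%N](_ : _ = 1%N) ?addn1 ?ltnS; last first.
  by rewrite /visits big_ord_recl big_ord0 /time_shift /= !addn0 wk eqxx.
by rewrite -(subnKC nk) visits_shift (leq_trans nK)// leq_addr.
Qed.

End last_visit.

(** * Measures determined by cylinders *)

Section uniqueness.
Context {R : realType} {E : pointedType}.
Hypothesis E_countable : countable [set: E].

(** Cylinders of length at least [n], with the empty set, form a pi-system: two
    of them are disjoint or nested.  The bound [n] is free because short
    cylinders are countable unions of long ones. *)
Lemma measure_eq_on_cylinders n (m1 m2 : {measure set (traj E) -> \bar R}) :
  (m1 setT < +oo)%E ->
  (forall k w, (n <= k)%N -> m1 (cylinder k w) = m2 (cylinder k w)) ->
  forall A, measurable A -> m1 A = m2 A.
Proof.
move=> m1oo m12.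
pose G : set (set (traj E)) :=
  [set A | A = set0 \/ exists2 k, (n <= k)%N & exists w, A = cylinder k w].
have mG A : G A -> measurable A.
  by move=> [->//|[k _ [w ->]]]; exact: past_measurable (past_cylinder w).
have [c cP] := cylinder_index E_countable n.
have level j : G [set w | c w = j].
  have [->|/set0P[w /= cw]] := eqVneq [set w | c w = j] set0; first by left.
  right; exists n => //; exists w; apply/seteqP; split=> w' /=.
    by move=> cw'; apply/cP; rewrite cw.
  by rewrite -cw => ?; exact/esym/cP.
apply: (measure_unique G (fun j => [set w | c w = j])).
- apply/seteqP; split; last first.
    by apply: smallest_sub; [exact: sigma_algebra_measurable|exact: mG].
  apply: smallest_sub; first exact: smallest_sigma_algebra.
  move=> _ [k _ [B _ <-]]; rewrite setTI.
  have [c' c'P] := cylinder_index E_countable (maxn n k).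
  have [_ _ GU] := smallest_sigma_algebra [set: traj E] G.
  have -> : (fun w : traj E => w k) @^-1` B =
      \bigcup_j ([set w | c' w = j] `&` (fun w : traj E => w k) @^-1` B).
    by apply/seteqP; split=> [w Dw|w [j _ []]//]; exists (c' w).
  apply: GU => j; set D := (X in _ `&` X).
  have [->|/set0P[w [/= cw Dw]]] := eqVneq ([set w | c' w = j] `&` D) set0.
    by apply: sub_sigma_algebra; left.
  apply: sub_sigma_algebra; right; exists (maxn n k); first exact: leq_maxl.
  exists w; apply/seteqP; split=> [w' [/= cw' _]|w' ww'].
    by apply/c'P; rewrite cw.
  split=> /=; first by rewrite -cw; apply/esym/c'P.
  by rewrite /D/= ww' ?leq_maxr.
- move=> A B [->|[k nk [w ->]]]; first by rewrite set0I; left.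
  move=> [->|[l nl [w' ->]]]; first by rewrite setI0; left.
  have [->|/set0P[v [wv w'v]]] := eqVneq (cylinder k w `&` cylinder l w') set0.
    by left.
  right; exists (maxn k l); first by rewrite leq_max nk.
  exists v; apply/seteqP; split=> [u [wu w'u] i|u vu].
    by rewrite leq_max => /orP[ik|il]; [rewrite wu// wv|rewrite w'u// w'v].
  by split; [apply: cylinder_trans wv _|apply: cylinder_trans w'v _];
    apply: cylinder_le vu; rewrite ?leq_maxl ?leq_maxr.
- exact: level.
- by apply/seteqP; split=> // w _; exists (c w).
- by move=> A [->|[k nk [w ->]]]; rewrite ?measure0 ?m12.
- by move=> j; apply: le_lt_trans m1oo; apply: le_measure; rewrite ?inE//;
    exact: mG.
Qed.

(** It suffices to check a Markov property on cylinders: both sides are finite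
    measures in [B]. *)
Lemma markov_extension (m1 m2 : {measure set (traj E) -> \bar R}) n
    (A : set (traj E)) (c : R) :
  (0 <= c) -> measurable A -> (m1 A < +oo)%E ->
  (forall m w, m1 (A `&` @time_shift E n @^-1` (cylinder m w)) =
     c%:E * m2 (cylinder m w))%E ->
  forall B, measurable B -> (m1 (A `&` @time_shift E n @^-1` B) = c%:E * m2 B)%E.
Proof.
move=> c0 mA A_fin cyl B mB.
pose k : {nonneg R} := NngNum c0.
pose m := pushforward (mrestr m1 mA) (@time_shift E n).
have mE C : m C = m1 (A `&` @time_shift E n @^-1` C) by rewrite setIC.
rewrite -mE -[RHS]/(mscale k m2 B).
apply: (@measure_eq_on_cylinders 0) => //; first exact: measurable_shift.
- by move=> ms; rewrite [X in (X < _)%E](mE setT) preimage_setT setIT.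
- by move=> ms j w _; rewrite [LHS](mE (cylinder j w)) cyl.
Qed.

(** Integrals of non-negative functions are sums over the countable partition
    into cylinders of length [n]. *)
Lemma ge0_eq_integral_cylinders n (m m' : {measure set (traj E) -> \bar R})
    (f g : traj E -> \bar R) :
  measurable_fun setT f -> (forall w, (0 <= f w)%E) ->
  measurable_fun setT g -> (forall w, (0 <= g w)%E) ->
  (forall w, (\int[m]_(v in cylinder n w) f v =
              \int[m']_(v in cylinder n w) g v)%E) ->
  (\int[m]_w f w = \int[m']_w g w)%E.
Proof.
move=> mf f0 mg g0 fg; have [c cP] := cylinder_index E_countable n.
have cE w : [set v | c v = c w] = cylinder n w.
  by apply/seteqP; split=> v /=; [move/esym/cP|move/cP/esym].
have TE : [set: traj E] = \bigcup_j [set w | c w = j].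
  by apply/seteqP; split=> // w _; exists (c w).
have mc j : measurable [set w : traj E | c w = j].
  have [->//|/set0P[w /= <-]] := eqVneq [set w : traj E | c w = j] set0.
  by rewrite cE; exact: past_measurable (past_cylinder w).
have tc : trivIset setT (fun j => [set w : traj E | c w = j]).
  apply/trivIsetP => i j _ _ /eqP ij; apply/seteqP; split=> // w [/= wi wj].
  by apply: ij; rewrite -wi.
rewrite TE !ge0_integral_bigcup// -?TE//.
apply: eq_eseriesr => j _.
have [->//|/set0P[w /= <-]] := eqVneq [set w : traj E | c w = j] set0.
  by rewrite !integral_set0.
by rewrite cE.
Qed.

End uniqueness.

Section change_of_variables.
Context {R : realType} d (T : measurableType d).
Variables (m1 m2 : {measure set T -> \bar R}).
Variables (theta : T -> T) (mtheta : measurable_fun setT theta).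
Local Open Scope ereal_scope.

(** Passage from sets to functions: restricted to [A], the image of [m1] under
    [theta] is the multiple [c] of [m2]. *)
Lemma ge0_integral_restr_pushforward (A : set T) (mA : measurable A)
    (c : R) (f : T -> \bar R) : (0 <= c)%R ->
  (forall B, measurable B -> m1 (A `&` theta @^-1` B) = c%:E * m2 B) ->
  measurable_fun setT f -> (forall w, 0 <= f w) ->
  \int[m1]_(w in A) f (theta w) = c%:E * \int[m2]_w f w.
Proof.
move=> c0 m12 mf f0.
pose k : {nonneg R} := NngNum c0.
pose mtheta_mixin := isMeasurableFun.Build _ _ _ _ _ mtheta.
pose th : {mfun _ >-> _} := HB.pack theta mtheta_mixin.
have mfth : measurable_fun setT (f \o theta) by exact: measurableT_comp.
rewrite -[c]/(k%:num) -ge0_integral_mscale//.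
rewrite -(@eq_measure_integral _ _ _ setT _
    (pushforward (mrestr m1 mA) th)) => [|B mB _]; last first.
  change (m1 (theta @^-1` B `&` A) = c%:E * m2 B).
  by rewrite setIC; exact: m12.
rewrite (@ge0_integral_pushforward _ _ _ _ _ th)// preimage_setT.
rewrite [RHS](@ge0_negligible_integral _ _ _ _ _ (~` A))//; last 3 first.
- exact: measurableC.
- by move=> w _; exact: f0.
- by rewrite /= /mrestr setICl measure0.
rewrite setTD setCK; apply: eq_measure_integral => B mB BA.
by change (m1 B = m1 (B `&` A)); rewrite (setIidl BA).
Qed.

End change_of_variables.

(** * The Markov property and recurrence of the chain *)

Section markov.
Context {R : realType} {E : pointedType}.
Hypothesis E_countable : countable [set: E].
Variables (p : E -> E -> R) (P : E -> probability (traj E) R).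
Hypothesis P_markov : markov_laws p P.

(** Chaining the one-step transition rule; only the position of [A] at time [n]
    enters, not the earlier past. *)
Lemma prob_cylinder_shift x n m (A : set (traj E)) (w : traj E) :
  determined n A -> (forall w', A w' -> w' n = w 0%N) ->
  P x (A `&` @time_shift E n @^-1` (cylinder m w)) =
  (P x A * (\prod_(i < m) p (w i) (w i.+1))%:E)%E.
Proof.
move=> dA Aw; elim: m => [|m IH].
  rewrite big_ord0 mule1; congr (P x _); apply/seteqP; split=> [w' []//|w' Aw'].
  by split=> // k; rewrite leqn0 => /eqP->; rewrite /time_shift addn0; exact: Aw.
set B := A `&` @time_shift E n @^-1` cylinder m w in IH *.
have dB : determined (n + m) B.
  apply: determinedI; first exact: determined_le (leq_addr _ _) dA.
  exact: (determined_shift (@determined_cylinder E m w)).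
have -> : A `&` @time_shift E n @^-1` cylinder m.+1 w =
    B `&` [set w' | w' (n + m).+1 = w m.+1].
  apply/seteqP; split=> [w' [Aw' ww']|w' [[Aw' ww'] /= w'm]].
    split; first by split=> // k km; apply: ww'; exact: leqW.
    by rewrite /= -addnS; exact: (ww' m.+1).
  split=> // k; rewrite leq_eqVlt => /predU1P[->|/ww'//].
  by rewrite /time_shift addnS.
rewrite (P_markov.2 x (n + m)%N (w m.+1)); last first.
  exact: (determined_past E_countable dB).
rewrite (eq_integral (cst (p (w m) (w m.+1))%:E)); last first.
  move=> w'; rewrite inE => -[_ /(_ m (leqnn m))].
  by rewrite /time_shift => ->.
rewrite integral_cst; last exact: (determined_measurable E_countable dB).
by rewrite big_ord_recr/= EFinM muleA -IH muleC.
Qed.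

Lemma prob_start x : P x [set w : traj E | w 0%N <> x] = 0%E.
Proof.
have m0 : measurable [set w : traj E | w 0%N = x].
  exact: (measurable_sigma_coord 0 [set x]).
have -> : [set w : traj E | w 0%N <> x] = ~` [set w | w 0%N = x] by [].
by rewrite probability_setC// P_markov.1 subee.
Qed.

Lemma prob_cylinder_markov x y n m (A : set (traj E)) (w : traj E) :
  determined n A -> (forall w', A w' -> w' n = y) ->
  P x (A `&` @time_shift E n @^-1` (cylinder m w)) =
  (P x A * P y (cylinder m w))%E.
Proof.
move=> dA Ay; have [yw|yw] := pselect (y = w 0%N).
  rewrite prob_cylinder_shift// -?yw//; congr (_ * _)%E.
  have := @prob_cylinder_shift y 0 m [set w | w 0%N = y] w.
  rewrite P_markov.1 mul1e => <-//; last 2 first.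
  - by move=> w1 w2 w12 /= <-; exact: w12.
  - by move=> w1 /= ->.
  congr (P y _); apply/seteqP; split=> [w' [_]//|w' ww'].
  by split => //=; rewrite ww'.
have -> : A `&` @time_shift E n @^-1` (cylinder m w) = set0.
  apply/seteqP; split=> // w' [/Ay w'n /(_ 0%N (leq0n m))].
  by rewrite /time_shift addn0 w'n.
suff -> : P y (cylinder m w) = 0%E by rewrite measure0 mule0.
apply: (@subset_measure0 _ _ _ _ _ [set w : traj E | w 0%N <> y]).
- exact: past_measurable (past_cylinder w).
- exact: (measurable_sigma_coord 0 (~` [set y])).
- by move=> w' ww' /= w'y; apply: yw; rewrite -w'y ww'.
- exact: prob_start.
Qed.

Lemma prob_markov x y n (A B : set (traj E)) :
  determined n A -> (forall w, A w -> w n = y) -> measurable B ->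
  (P x (A `&` @time_shift E n @^-1` B) = P x A * P y B)%E.
Proof.
move=> dA Ay mB; have mA := determined_measurable E_countable dA.
have PA : P x A \is a fin_num by exact: fin_num_measure.
rewrite -(fineK PA); apply: (markov_extension E_countable) => //.
- exact: fine_ge0.
- by rewrite ltey_eq PA.
- by move=> m w; rewrite fineK//; exact: prob_cylinder_markov.
Qed.

Hypotheses (P_irreducible : irreducible P) (P_recurrent : recurrent P).
Variable x0 : E.

(** The case [x = x0] is recurrence of [x0].  In general, a chain started at [x0]
    reaches [x] with positive probability at some time [n]; were [x0] then
    avoided with positive probability from [x], the Markov property at time [n]
    would contradict recurrence. *)
Lemma prob_avoids_from x k : P x (avoids_from x0 k) = 0%E.
Proof.
have ml j : measurable (avoids_from x0 j) by exact: measurable_avoids_from.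
have P0 j : P x0 (avoids_from x0 j) = 0%E.
  pose L := lim_sup_set (fun n => [set w : traj E | w n = x0]).
  have mL : measurable L.
    apply: bigcapT_measurable => n; apply: bigcup_measurable => i _.
    exact: (measurable_sigma_coord i [set x0]).
  have PL : P x0 (~` L) = 0%E by rewrite probability_setC// P_recurrent subee.
  apply: subset_measure0 PL => //; first exact: measurableC.
  by move=> w aw /(_ j Logic.I)[i /= /aw].
have [n] := P_irreducible x0 x.
set A := [set w : traj E | w n = x] => PA.
have dA : determined n A by move=> w w' ww' /=; rewrite /A /= ww'.
apply/eqP; have /eqP := prob_markov x0 dA (fun w h => h) (ml k).
rewrite shift_avoids_from (_ : P x0 _ = 0%E); last first.
  apply: subset_measure0 (P0 (n + k)%N) => //.
  apply: measurableI => //; exact: (determined_measurable E_countable dA).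
by rewrite eq_sym mule_eq0 gt_eqF.
Qed.

End markov.

(** * The penalised measure and its reweighting *)

(** Infinite [l] is covered because the factor [r ^- k] is positive and
    finite. *)
Lemma epowD (R : realType) (r : R) k (l : \bar R) : 0 < r ->
  epow r^-1 ((k%:R)%:E + l) = ((r ^- k)%:E * epow r^-1 l)%E.
Proof.
move=> r0; case: l => [l||] /=.
- rewrite powRD; last by rewrite (gt_eqF (_ : 0 < r^-1)) ?invr_gt0// implybT.
  by rewrite powR_mulrn ?exprVn// invr_ge0 ltW.
- by rewrite gt0_muley// lte_fin invr_gt0 exprn_gt0.
- by rewrite mule0.
Qed.

Section penalised.
Context {R : realType} {E : pointedType}.
Hypothesis E_countable : countable [set: E].
Variables (P : E -> probability (traj E) R) (phi : E -> R) (x0 : E) (r : R).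
Hypotheses (phi_ge0 : forall x, 0 <= phi x) (phi_x0 : phi x0 = 0).
Hypothesis r01 : 0 < r < 1.
Variable x : E.
Hypothesis P_avoids : forall n, P x (avoids_from x0 n) = 0%E.
Variable m : {finite_measure set (traj E) -> \bar R}.
Hypothesis m_pen : is_penalised P phi x0 r x m.

Let c : R := r / (1 - r) * fine ('E_(P x0)[fun w : traj E => phi (w 1%N)])%E.

Let r_gt0 : 0 < r. Proof. by case/andP: r01. Qed.
Let r_lt1 : r < 1. Proof. by case/andP: r01. Qed.

Let c_ge0 : 0 <= c.
Proof.
rewrite mulr_ge0 ?divr_ge0 ?subr_ge0 ?(ltW r_gt0) ?(ltW r_lt1)//.
by apply/fine_ge0/expectation_ge0 => w.
Qed.

Let rX_ge0 k : 0 <= r ^+ k. Proof. by rewrite exprn_ge0 ?ltW. Qed.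

Let rX_le1 k : r ^+ k <= 1. Proof. by rewrite exprn_ile1 ?ltW. Qed.

Let measurable_rvisits n (D : set (traj E)) :
  measurable_fun D (fun w => (r ^+ visits x0 n w)%:E).
Proof.
apply/measurable_EFinP; apply: measurable_funTS.
apply: (determined_measurable_fun E_countable (n := n)) => w w' ww'.
by rewrite (visits_cylinder x0 (leqnSn n) ww').
Qed.

Let measurable_phi N n (D : set (traj E)) :
  measurable_fun D (fun w => (phi (w N) * r ^+ visits x0 n w)%:E).
Proof.
apply/measurable_EFinP; apply: measurable_funTS.
apply: measurable_funM; last first.
  apply: (determined_measurable_fun E_countable (n := n)) => w w' ww'.
  by rewrite (visits_cylinder x0 (leqnSn n) ww').
by apply: (determined_measurable_fun E_countable (n := N)) => w w' ->.
Qed.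

(** The density of [m] at time [N], with [psi] split as [c + phi] and the
    exponent frozen at its value at time [n]. *)
Lemma penalised_split n N (D : set (traj E)) : (n <= N)%N ->
  determined N D -> D `<=` avoids x0 n N ->
  (m D = c%:E * \int[P x]_(w in D) (r ^+ visits x0 n w)%:E
       + \int[P x]_(w in D) (phi (w N) * r ^+ visits x0 n w)%:E)%E.
Proof.
move=> nN dD Dav; have mD := determined_measurable E_countable dD.
rewrite (m_pen (determined_past E_countable dD)) -ge0_integralZl//; last first.
  by move=> w _; rewrite lee_fin.
rewrite -ge0_integralD//=; last 3 first.
- by move=> w _; rewrite mule_ge0// lee_fin.
- by apply: measurable_funeM; exact: measurable_rvisits.
- by move=> w _; rewrite lee_fin mulr_ge0.
apply: eq_integral => w; rewrite inE => Dw.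
by rewrite (visits_avoids nN (Dav _ Dw)) /psi -/c mulrDl -EFinM -EFinD.
Qed.

(** The martingale property of [phi (X_N)] stopped at the first visit to [x0]
    after [n].  It is read off from [m]: the mass of the event [D] that [x0] is
    avoided up to and including time [n + N] can be computed with the density at
    time [n + N] or one step later, and the terms in [c] agree.  Passing between
    [D] and the event where [n + N] is left out changes nothing as
    [phi x0 = 0]. *)
Lemma expectation_phi_avoids n N (A : set (traj E)) : determined n A ->
  (\int[P x]_(w in A `&` avoids x0 n (n + N))
      (phi (w (n + N)%N) * r ^+ visits x0 n w)%:E =
   \int[P x]_(w in A) (phi (w n) * r ^+ visits x0 n w)%:E)%E.
Proof.
move=> dA; elim: N => [|N <-].
  rewrite addn0 (_ : avoids x0 n n = setT) ?setIT//.
  by apply/seteqP; split=> // w _ k; rewrite ltnNge; case: leqP.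
set D := A `&` avoids x0 n (n + N.+1).
have dD : determined (n + N) D.
  apply: determinedI; first exact: (determined_le (leq_addr N n) dA).
  by rewrite addnS; exact: determined_avoids.
have mD := determined_measurable E_countable dD.
set J := (c%:E * \int[P x]_(w in D) (r ^+ visits x0 n w)%:E)%E.
have fin : J \is a fin_num.
  rewrite fin_numM// ge0_fin_numE; last first.
    by apply: integral_ge0 => w _; rewrite lee_fin.
  apply: (@le_lt_trans _ _ (\int[P x]_(w in D) (cst 1) w)%E).
    by apply: ge0_le_integral => // [w _|w _]; rewrite lee_fin.
  by rewrite integral_cst// mul1e ltey_eq fin_num_measure.
have := @penalised_split n (n + N.+1) D (leq_addr _ _).
rewrite (@penalised_split n (n + N) D (leq_addr _ _))//; last first.
  move=> w [_ aw] k /andP[nk kN]; apply: aw.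
  by rewrite nk addnS ltnS ltnW.
have dD' : determined (n + N.+1) D by apply: determined_le dD; rewrite addnS.
rewrite -/J => /(_ dD' (@subIsetr _ _ _)) /(congr1 (fun z => z - J)%E).
rewrite !(addeC J) !addeK// => <-.
(* The two domains differ by trajectories that are at [x0] at time [n + N]. *)
rewrite [LHS]integral_mkcond [RHS]integral_mkcond; apply: eq_integral => w _.
rewrite !patchE; case: ifPn => [/set_mem Dw|Dw].
  rewrite ifT// inE; split; first exact: Dw.1.
  move=> k /andP[nk kN]; apply: Dw.2.
  by rewrite nk addnS ltnS ltnW.
case: ifPn => // /set_mem[Aw aw].
have [->|wx0] := pselect (w (n + N)%N = x0); first by rewrite phi_x0 mul0r.
case/negP: Dw; rewrite inE; split=> // k /andP[nk].
rewrite addnS ltnS leq_eqVlt => /predU1P[->//|kN]; apply: aw.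
by rewrite nk.
Qed.

(** Letting the horizon [N] of [penalised_split] tend to infinity: the term in
    [c] is at most [c] times the probability that [x0] is avoided during
    [[n, n + N)], which tends to [0] by recurrence. *)
Lemma penalised_late n (A : set (traj E)) : determined n A ->
  (m (A `&` avoids_from x0 n) =
   \int[P x]_(w in A) (phi (w n) * r ^+ visits x0 n w)%:E)%E.
Proof.
move=> dA; set K := RHS.
pose B N := A `&` avoids x0 n (n + N).
have dB N : determined (n + N) (B N).
  apply: determinedI; first exact: (determined_le (leq_addr N n) dA).
  exact: (determined_avoids (leqnSn _)).
have mB N : measurable (B N) := determined_measurable E_countable (dB N).
have BE : A `&` avoids_from x0 n = \bigcap_N B N.
  by rewrite avoids_from_bigcap -bigcapIr//; exists 0%N.
have niB : nonincreasing_seq B.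
  move=> i j ij; apply/subsetPset => w [Aw aw]; split=> // k /andP[nk ki].
  by apply: aw; rewrite nk (leq_trans ki)// leq_add2l.
have cvgB (m' : {measure set (traj E) -> \bar R}) : (m' setT < +oo)%E ->
    m' (B N) @[N --> \oo] --> m' (A `&` avoids_from x0 n).
  move=> m'oo; rewrite BE; apply: nonincreasing_cvg_mu => //.
    by apply: le_lt_trans m'oo; apply: le_measure; rewrite ?inE.
  exact: bigcapT_measurable.
pose J N := (\int[P x]_(w in B N) (r ^+ visits x0 n w)%:E)%E.
have J0 : J N @[N --> \oo] --> 0%E.
  have : P x (B N) @[N --> \oo] --> P x (A `&` avoids_from x0 n).
    by apply: cvgB; rewrite ltey_eq fin_num_measure.
  rewrite (_ : P x (A `&` _) = 0%E); last first.
    apply: subset_measure0 (P_avoids n) => //; last exact: measurable_avoids_from.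
    by rewrite BE; exact: bigcapT_measurable.
  apply: squeeze_cvge; last exact: cvg_cst.
  apply: nearW => N; rewrite integral_ge0/=; last by move=> w _; rewrite lee_fin.
  rewrite -[leRHS]mul1e -integral_cst//.
  by apply: ge0_le_integral => // w _; rewrite lee_fin.
have mBE N : (m (B N) = c%:E * J N + K)%E.
  rewrite (@penalised_split n (n + N))//; [|exact: leq_addr|exact: subIsetr].
  by rewrite expectation_phi_avoids.
have : (c%:E * J N + K)%E @[N --> \oo] --> m (A `&` avoids_from x0 n).
  by rewrite -(funext mBE); apply: cvgB; exact: fin_num_fun_lty (fin_num_measure m).
have : (c%:E * J N + K)%E @[N --> \oo] --> (c%:E * 0 + K)%E.
  apply: cvgeD; [by rewrite mule0 fin_num_adde_defr| |exact: cvg_cst].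
  exact: cvgeZl.
by rewrite mule0 add0e => cvgK cvgm; exact: cvg_unique cvgm cvgK.
Qed.

Lemma cvg_expectation_rvisits :
  (\int[P x]_w (r ^+ visits x0 n w)%:E)%E @[n --> \oo] --> 0%E.
Proof.
pose f n (w : traj E) := (r ^+ visits x0 n w)%:E.
have [||| _ _] := @dominated_convergence _ _ R (P x) setT measurableT
  f (cst 0%E) (cst 1%E) (fun n => @measurable_rvisits n setT)
  (@measurable_cst _ _ _ _ _ _); last by rewrite integral_cst// mul0e.
- apply: (@negligibleS _ _ _ _ (\bigcup_n avoids_from x0 n)); last first.
    apply: negligible_bigcup => n; apply/negligibleP; last exact: P_avoids.
    exact: measurable_avoids_from.
  move=> w /=; apply: contra_notP => nw _.
  have io n : ~ avoids_from x0 n w by move=> aw; apply: nw; exists n.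
  apply: (@cvg_comp _ _ _ (fun n => visits x0 n w) (fun k => (r ^+ k)%:E)).
    exact: cvg_visits_pinfty io.
  apply: cvg_EFin; first exact: nearW.
  by apply: cvg_expr; rewrite ger0_norm ?ltW.
- exact: finite_measure_integrable_cst.
- by apply: aeW => w n _; rewrite gee0_abs lee_fin.
Qed.

(** The total mass is [c E[r^visits before n] + m (avoids_from x0 n)], so the
    complement of [avoids_from x0 n] has mass [c E[r^visits before n]]. *)
Lemma penalised_io_null : m (\bigcap_n ~` avoids_from x0 n) = 0%E.
Proof.
have mav n : measurable (avoids_from x0 n) by exact: measurable_avoids_from.
have compl n : m (~` avoids_from x0 n) =
    (c%:E * \int[P x]_w (r ^+ visits x0 n w)%:E)%E.
  have dT : determined n [set: traj E] by [].
  have avT : setT `<=` avoids x0 n n by move=> w _ k; rewrite ltnNge; case: leqP.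
  have := penalised_split (leqnn n) dT avT.
  rewrite -penalised_late// setTI.
  have -> : m setT = (m (~` avoids_from x0 n) + m (avoids_from x0 n))%E.
    by rewrite -measureU ?setUCl ?setICl//; exact: measurableC.
  move=> /(congr1 (fun z => z - m (avoids_from x0 n))%E).
  by rewrite !addeK ?fin_num_measure.
apply/eqP; rewrite -measure_le0.
have : (c%:E * \int[P x]_w (r ^+ visits x0 n w)%:E)%E @[n --> \oo] --> 0%E.
  by rewrite -[X in _ --> X](mule0 c%:E); apply: cvgeZl => //;
    exact: cvg_expectation_rvisits.
apply: cvge_ge; apply: nearW => n; rewrite -compl.
apply: le_measure; rewrite ?inE//; [|exact: measurableC|].
  by apply: bigcapT_measurable => k; exact: measurableC.
by move=> w; exact.
Qed.

Lemma epow_nat k : epow r^-1 (k%:R)%:E = (r ^- k)%:E.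
Proof. by rewrite /= powR_mulrn ?exprVn// invr_ge0 ltW. Qed.

Lemma weighted_io_null : weighted x0 r m (\bigcap_n ~` avoids_from x0 n) = 0%E.
Proof.
have mG : measurable (\bigcap_n ~` avoids_from x0 n).
  by apply: bigcapT_measurable => k; apply: measurableC;
    exact: measurable_avoids_from.
apply: null_set_integral => //; last exact: penalised_io_null.
apply: measurable_funTS; apply: measurableT_comp; first exact: measurable_epow.
exact: measurable_total_visits.
Qed.

Lemma weighted_visits_const n k (A : set (traj E)) : measurable A ->
  A `<=` avoids_from x0 n -> (forall w, A w -> visits x0 n w = k) ->
  weighted x0 r m A = ((r ^- k)%:E * m A)%E.
Proof.
move=> mA Aav Ak; rewrite /weighted (eq_integral (cst (r ^- k)%:E)).
  by rewrite integral_cst.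
move=> w; rewrite inE => Aw.
by rewrite (total_visits_avoids_from _ (Aav _ Aw)) (Ak _ Aw) epow_nat.
Qed.

(** The parameter [r] cancels here: [m] contributes [r ^+ visits] and the weight
    its inverse, with the same exponent because [n] is past the last visit. *)
Lemma weighted_cylinder_late n (w : traj E) :
  weighted x0 r m (cylinder n w `&` avoids_from x0 n) =
  ((phi (w n))%:E * P x (cylinder n w))%E.
Proof.
have mC := past_measurable (past_cylinder (n := n) w).
rewrite (@weighted_visits_const n (visits x0 n w)); first last.
- by move=> w' [ww' _]; exact: visits_cylinder (leqnSn n) ww'.
- exact: subIsetr.
- apply: measurableI => //; exact: measurable_avoids_from.
rewrite penalised_late; last exact: determined_cylinder.
rewrite (eq_integral (cst (phi (w n) * r ^+ visits x0 n w)%:E)).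
  rewrite integral_cst// muleA -EFinM mulrCA mulVf ?mulr1//.
  by rewrite expf_neq0// gt_eqF.
move=> w'; rewrite inE => ww'.
by rewrite ww'// (visits_cylinder x0 (leqnSn n) ww').
Qed.

(** At most [n] visits occur here, so the weight is at most [r ^- n]. *)
Lemma weighted_avoids_from_lty n : (weighted x0 r m (avoids_from x0 n) < +oo)%E.
Proof.
have mav : measurable (avoids_from x0 n) by exact: measurable_avoids_from.
apply: (@le_lt_trans _ _ (\int[m]_(w in avoids_from x0 n) (cst (r ^- n)%:E w))%E).
  apply: ge0_le_integral => //.
  - by move=> w _; exact: epow_ge0.
  - apply: measurable_funTS; apply: measurableT_comp.
      exact: measurable_epow.
    exact: measurable_total_visits.
  - move=> w aw; rewrite (total_visits_avoids_from _ aw) epow_nat /= lee_fin.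
    rewrite lef_pV2 ?posrE ?exprn_gt0//.
    apply: ler_wiXn2l => //; rewrite ?ltW//.
    rewrite /visits -[leqRHS]card_ord -sum1_card; apply: leq_sum => k _.
    exact: leq_b1.
by rewrite integral_cst// ltey_eq fin_numM// fin_num_measure.
Qed.

End penalised.

Section independence.
Context {R : realType} {E : pointedType}.
Hypothesis E_countable : countable [set: E].
Variables (P : E -> probability (traj E) R) (phi : E -> R) (x0 : E).
Hypotheses (phi_ge0 : forall x, 0 <= phi x) (phi_x0 : phi x0 = 0).
Variable x : E.
Hypothesis P_avoids : forall n, P x (avoids_from x0 n) = 0%E.

(** The pieces are the events of no visit after [n] and the null event of
    infinitely many visits. *)
Lemma weighted_sigma_finite (r : R) (m : {finite_measure set (traj E) -> \bar R}) :
  0 < r < 1 -> is_penalised P phi x0 r x m ->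
  sigma_finite [set: traj E] (weighted x0 r m).
Proof.
move=> r01 mP.
have mav n : measurable (avoids_from x0 n) by exact: measurable_avoids_from.
exists (fun n => if n is n'.+1 then avoids_from x0 n'
                 else \bigcap_n ~` avoids_from x0 n).
  apply/esym; rewrite -subTset => w _.
  have [[n aw]|naw] := pselect (exists n, avoids_from x0 n w).
    by exists n.+1.
  by exists 0%N => // n _ aw; apply: naw; exists n.
case=> [|n]; split => //.
- by apply: bigcapT_measurable => n; exact: measurableC.
- by rewrite (weighted_io_null E_countable phi_ge0 phi_x0 r01 P_avoids mP).
- exact: weighted_avoids_from_lty.
Qed.

(** On [avoids_from x0 n] the two measures agree on all cylinders of length at
    least [n]; then [n] tends to infinity, the limit event being of full
    measure for both. *)
Lemma weighted_independent (r s : R)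
    (m m' : {finite_measure set (traj E) -> \bar R}) :
  0 < r < 1 -> 0 < s < 1 ->
  is_penalised P phi x0 r x m -> is_penalised P phi x0 s x m' ->
  forall A, measurable A -> weighted x0 r m A = weighted x0 s m' A.
Proof.
move=> r01 s01 mP m'P A mA.
have mav n : measurable (avoids_from x0 n) by exact: measurable_avoids_from.
have trace n : forall B, measurable B ->
    weighted x0 r m (B `&` avoids_from x0 n) =
    weighted x0 s m' (B `&` avoids_from x0 n).
  move=> B mB.
  have := @measure_eq_on_cylinders R E E_countable n
    (mrestr (weighted x0 r m) (mav n)) (mrestr (weighted x0 s m') (mav n)).
  move=> /(_ _ _ B mB); apply.
    rewrite /= /mrestr setTI.
    exact: weighted_avoids_from_lty.
  move=> k w nk; rewrite /= /mrestr.
  have [->|->] := cylinder_avoids_from x0 w nk; last by rewrite !measure0.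
  rewrite (weighted_cylinder_late E_countable phi_ge0 phi_x0 r01 P_avoids mP).
  by rewrite (weighted_cylinder_late E_countable phi_ge0 phi_x0 s01 P_avoids m'P).
set G := \bigcap_n ~` avoids_from x0 n.
have mG : measurable G by apply: bigcapT_measurable => n; exact: measurableC.
have split_late (M : {measure set (traj E) -> \bar R}) : M G = 0%E ->
    M (A `&` avoids_from x0 n) @[n --> \oo] --> M A.
  move=> MG0.
  have -> : M A = M (\bigcup_n (A `&` avoids_from x0 n)).
    have -> : \bigcup_n (A `&` avoids_from x0 n) = A `\` G.
      rewrite -setI_bigcupr setDE /G setC_bigcap; congr (_ `&` _).
      by apply: eq_bigcupr => n _; rewrite setCK.
    rewrite (measureDI M mA mG) [X in (_ + X)%E](_ : _ = 0%E) ?adde0//.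
    by apply: subset_measure0 MG0 => //; exact: measurableI.
  apply: nondecreasing_cvg_mu => [n||i j ij].
  - exact: measurableI.
  - by apply: bigcupT_measurable => n; exact: measurableI.
  - by apply/subsetPset; apply: setIS; exact: avoids_from_le.
have := split_late (weighted x0 s m')
  (weighted_io_null E_countable phi_ge0 phi_x0 s01 P_avoids m'P).
rewrite -(funext (fun n => trace n A mA)) => cs.
have cr := split_late (weighted x0 r m)
  (weighted_io_null E_countable phi_ge0 phi_x0 r01 P_avoids mP).
exact: cvg_unique cr cs.
Qed.

End independence.

(** * The Markov property of the reweighted measure *)

Section penalised_markov.
Context {R : realType} {E : pointedType}.
Hypothesis E_countable : countable [set: E].
Variables (p : E -> E -> R) (P : E -> probability (traj E) R).
Hypotheses (P_markov : markov_laws p P).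
Variables (phi : E -> R) (x0 : E) (r : R).
Hypothesis r_gt0 : 0 < r.
Variable m : E -> {finite_measure set (traj E) -> \bar R}.
Hypothesis m_pen : forall x, is_penalised P phi x0 r x (m x).

(** The exponent of [r] is additive in time, so the density of [m x] at time
    [n + j] is [r ^+ visits x0 n] times the density of [m (w n)] at time [j] for
    the shifted trajectory. *)
Lemma penalised_markov x n (w : traj E) (B : set (traj E)) : measurable B ->
  (m x (cylinder n w `&` @time_shift E n @^-1` B) =
   (r ^+ visits x0 n w * fine (P x (cylinder n w)))%:E * m (w n) B)%E.
Proof.
have mC := past_measurable (past_cylinder (n := n) w).
have PC : P x (cylinder n w) \is a fin_num by exact: fin_num_measure.
apply: (markov_extension E_countable) => //.
- by rewrite mulr_ge0 ?exprn_ge0 ?fine_ge0// ltW.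
- by rewrite ltey_eq fin_num_measure.
move=> j v; set D := _ `&` _.
have dC : determined n (cylinder n w) by exact: determined_cylinder.
have dD : determined (n + j) D.
  apply: determinedI; first exact: (determined_le (leq_addr _ _) dC).
  exact: (determined_shift (@determined_cylinder E j v)).
rewrite [LHS](m_pen _ (determined_past E_countable dD)).
rewrite [X in (_ * X)%E](m_pen _ (past_cylinder (n := j) v)).
rewrite (eq_integral (cst (psi P phi x0 r (v j) *
    r ^+ (visits x0 n w + visits x0 j v))%:E)); last first.
  move=> u; rewrite inE => -[wu vu].
  rewrite visits_shift (visits_cylinder x0 (leqnSn n) wu).
  by rewrite (visits_cylinder x0 (leqnSn j) vu) -(vu j (leqnn j)).
rewrite integral_cst; last exact: (determined_measurable E_countable dD).
rewrite (eq_integral (cst (psi P phi x0 r (v j) *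
    r ^+ visits x0 j v)%:E)); last first.
  move=> u; rewrite inE => vu.
  by rewrite (visits_cylinder x0 (leqnSn j) vu) -(vu j (leqnn j)).
rewrite integral_cst; last exact: past_measurable (past_cylinder v).
rewrite [X in (_ * X)%E = _](_ : _ = (fine (P x (cylinder n w)))%:E *
    P (w n) (cylinder j v))%E; last first.
  rewrite fineK//; apply: (prob_cylinder_markov E_countable P_markov) => //.
  by move=> u; exact.
by rewrite !muleA -!EFinM exprD; congr (_%:E * _)%E; ring.
Qed.

(** The total number of visits is additive as well; the weight of the first [n]
    steps cancels the power of [r] in [penalised_markov]. *)
Lemma weighted_markov x n (w : traj E) (B : set (traj E)) : measurable B ->
  (weighted x0 r (m x) (cylinder n w `&` @time_shift E n @^-1` B) =
   (fine (P x (cylinder n w)))%:E * weighted x0 r (m (w n)) B)%E.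
Proof.
move=> mB; have mC := past_measurable (past_cylinder (n := n) w).
(* On the cylinder the weight of a trajectory is [f] of its shift. *)
pose f (v : traj E) : \bar R :=
  ((r ^- visits x0 n w)%:E * epow r^-1 (total_visits R x0 v))%E.
have f0 v : (0 <= f v)%E.
  by rewrite mule_ge0 ?epow_ge0// lee_fin invr_ge0 exprn_ge0 ?ltW.
have mep : measurable_fun [set: traj E]
    (fun v => epow r^-1 (total_visits R x0 v)).
  by apply: measurableT_comp; [exact: measurable_epow|
    exact: measurable_total_visits].
have mf : measurable_fun setT f by exact: measurable_funeM.
rewrite /weighted integral_mkcondr.
rewrite (eq_integral ((f \_ B) \o @time_shift E n)); last first.
  move=> u; rewrite inE => wu /=; rewrite !patchE.
  rewrite (_ : (u \in _) = (time_shift n u \in B)); last first.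
    by apply/idP/idP; rewrite !inE.
  case: ifP => // _.
  by rewrite (total_visits_shift _ _ n) epowD// (visits_cylinder x0 (leqnSn n) wu).
rewrite (ge0_integral_restr_pushforward (m1 := m x) (m2 := m (w n))
  (@measurable_shift E n) mC _ (fun B mB => @penalised_markov x n w B mB)).
- rewrite -integral_mkcond ge0_integralZl//.
  + rewrite muleA -EFinM mulrAC mulfV ?mul1r//.
    by rewrite expf_neq0// gt_eqF.
  + exact: measurable_funTS.
  + by move=> v _; exact: epow_ge0.
  + by rewrite lee_fin invr_ge0 exprn_ge0 ?ltW.
- by rewrite mulr_ge0 ?exprn_ge0 ?fine_ge0// ltW.
- apply/(measurable_restrictT _ mB); exact: measurable_funTS.
- by move=> v; rewrite patchE; case: ifP.
Qed.

End penalised_markov.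

(** * Infinite products along a trajectory *)

Section infinite_products.
Context {R : realType} {E : pointedType}.
Variable q : E -> R.
Hypothesis q01 : forall y, 0 <= q y <= 1.

Lemma cvg_infinite_prod (w : traj E) :
  (\prod_(k < n) q (w k)) @[n --> \oo] --> infinite_prod q w.
Proof.
apply: nonincreasing_is_cvgn.
  apply/nonincreasing_seqP => n; rewrite big_ord_recr/= ler_piMr//.
    by apply: prodr_ge0 => k _; case/andP: (q01 (w k)).
  by case/andP: (q01 (w n)).
exists 0 => _ [n _ <-].
by apply: prodr_ge0 => k _; case/andP: (q01 (w k)).
Qed.

Lemma infinite_prod_ge0 (w : traj E) : 0 <= infinite_prod q w.
Proof.
apply: limr_ge; first exact/cvg_infinite_prod.
by apply: nearW => n; apply: prodr_ge0 => k _; case/andP: (q01 (w k)).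
Qed.

Lemma infinite_prod_shift n (w : traj E) :
  infinite_prod q w =
  (\prod_(k < n) q (w k)) * infinite_prod q (time_shift n w).
Proof.
apply/cvg_lim => //; rewrite -(cvg_shiftn n).
under eq_fun do rewrite addnC big_split_ord/=.
by apply: cvgMr; exact: cvg_infinite_prod.
Qed.

Lemma measurable_infinite_prod (E_countable : countable [set: E]) :
  measurable_fun [set: traj E] (infinite_prod q).
Proof.
apply: (measurable_fun_cvg (h := fun n (w : traj E) => \prod_(k < n) q (w k)))
  => [n|w _]; last exact: cvg_infinite_prod.
apply: (determined_measurable_fun E_countable (n := n)) => w w' ww'.
by apply: eq_bigr => k _; rewrite ww'// ltnW.
Qed.

End infinite_products.

(** * The theorem *)

Theorem theorem4p1p3 (R : realType) (E : pointedType)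
  (E_countable : countable [set: E])
  (p : E -> E -> R) (p_stochastic : stochastic p)
  (P : E -> probability (traj E) R) (P_markov : markov_laws p P)
  (p_finite : forall x, finite_set [set y | 0 < p x y])
  (P_irreducible : irreducible P)
  (P_recurrent : recurrent P)
  (x0 : E) (phi : E -> R)
  (phi_ge0 : forall x, 0 <= phi x)
  (phi_x0 : phi x0 = 0)
  (phi_harmonic : forall x, x <> x0 ->
     ('E_(P x)[fun w : traj E => phi (w 1%N)] = (phi x)%:E)%E)
  (phi_unbounded : forall M : R, exists y, M < phi y)
  (mu : R -> E -> {finite_measure set (traj E) -> \bar R})
  (mu_penalised : forall (r : R) (x : E), 0 < r < 1 ->
     is_penalised P phi x0 r x (mu r x)) :
  (* (i) *)
  (forall x : E,
     (forall r : R, 0 < r < 1 ->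
        sigma_finite [set: traj E] (weighted x0 r (mu r x))) /\
     (forall r s : R, 0 < r < 1 -> 0 < s < 1 ->
        forall A : set (traj E), measurable A ->
        weighted x0 r (mu r x) A = weighted x0 s (mu s x) A)) /\
  (* (ii) *)
  (forall Q : E -> {measure set (traj E) -> \bar R},
     (forall (r : R) (x : E), 0 < r < 1 ->
        forall A : set (traj E), measurable A ->
        Q x A = weighted x0 r (mu r x) A) ->
     forall (x : E) (n : nat) (F : traj E -> \bar R),
     (forall w, (0 <= F w)%E) ->
     (forall B : set (\bar R), measurable B -> past n (F @^-1` B)) ->
     forall q : E -> R,
     (forall y, 0 <= q y <= 1) ->
     finite_set [set y | q y < 1] ->
     (\int[Q x]_w (F w * (infinite_prod q w)%:E) =
      \int[P x]_w (F w * psi_q Q q (w n) * (\prod_(k < n) q (w k))%:E))%E).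
Proof.
have P_avoids x n : P x (avoids_from x0 n) = 0%E.
  exact: (prob_avoids_from E_countable P_markov P_irreducible P_recurrent).
split=> [x|Q QE x n F F0 mF q q01 _].
  split=> [r r01|r s r01 s01 A mA].
    exact: (weighted_sigma_finite E_countable phi_ge0 phi_x0 (P_avoids x) r01
      (mu_penalised r x r01)).
  exact: (weighted_independent E_countable phi_ge0 phi_x0 (P_avoids x) r01 s01
    (mu_penalised r x r01) (mu_penalised s x s01)).
(* Any parameter in (0, 1) represents [Q]. *)
pose r : R := 2^-1.
have r01 : 0 < r < 1 by rewrite invr_gt0 ltr0n /= invf_lt1 ?ltr1n.
have r0 : 0 < r by case/andP: r01.
pose G (w : traj E) := (infinite_prod q w)%:E.
have G0 w : (0 <= G w)%E by rewrite lee_fin infinite_prod_ge0.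
have mG : measurable_fun [set: traj E] G.
  by apply/measurable_EFinP; exact: measurable_infinite_prod.
have prod0 (w : traj E) : 0 <= \prod_(k < n) q (w k).
  by apply: prodr_ge0 => k _; case/andP: (q01 (w k)).
have FE w w' : cylinder n w w' -> F w' = F w.
  move=> ww'.
  by have /past_determined/(_ _ _ ww') := mF _ (emeasurable_set1 (F w)); apply.
have mFt : measurable_fun setT F.
  exact: (determined_measurable_fun E_countable FE).
have psi0 y : (0 <= psi_q Q q y)%E by apply: integral_ge0 => w _; exact: G0.
have mR : measurable_fun [set: traj E]
    (fun w => (F w * psi_q Q q (w n) * (\prod_(k < n) q (w k))%:E)%E).
  apply: (determined_measurable_fun E_countable (n := n)) => w w' ww'.
  rewrite (FE _ _ ww') ww'//; congr (_ * _%:E)%E.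
  by apply: eq_bigr => k _; rewrite ww'// ltnW.
apply: (ge0_eq_integral_cylinders E_countable (n := n)) => //.
- exact: emeasurable_funM.
- by move=> w; apply: mule_ge0; [exact: F0|exact: G0].
- by move=> w; rewrite mule_ge0 ?mule_ge0 ?F0// lee_fin.
move=> w.
have mC := past_measurable (past_cylinder (n := n) w).
have PC : P x (cylinder n w) \is a fin_num by exact: fin_num_measure.
have markov (B : set (traj E)) : measurable B ->
    (Q x (cylinder n w `&` @time_shift E n @^-1` B) =
     (fine (P x (cylinder n w)))%:E * Q (w n) B)%E.
  move=> mB; rewrite (QE _ _ r01) ?(QE _ (w n) r01)//.
    exact: (weighted_markov E_countable P_markov r0 (fun x => mu_penalised r x r01)).
  apply: measurableI => //; rewrite -[X in measurable X]setTI.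
  exact: measurable_shift.
rewrite (eq_integral (fun v => F w * (\prod_(k < n) q (w k))%:E *
    G (time_shift n v))%E); last first.
  move=> v; rewrite inE => wv; rewrite (FE _ _ wv) -muleA; congr (_ * _)%E.
  rewrite (infinite_prod_shift q01 n v) EFinM; congr (_%:E * _)%E.
  by apply: eq_bigr => k _; rewrite wv// ltnW.
rewrite ge0_integralZl//; last 2 first.
- apply: measurable_funTS; apply: measurableT_comp => //.
  exact: measurable_shift.
- by rewrite mule_ge0 ?F0// lee_fin.
rewrite (ge0_integral_restr_pushforward (@measurable_shift E n) mC _ markov)//;
  last exact: fine_ge0.
rewrite [RHS](eq_integral (cst (F w * psi_q Q q (w n) *
    (\prod_(k < n) q (w k))%:E)%E)); last first.
  move=> v; rewrite inE => wv; rewrite (FE _ _ wv) wv//.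
  congr (_ * _%:E)%E.
  by apply: eq_bigr => k _; rewrite wv// ltnW.
rewrite integral_cst// fineK//.
by rewrite -!muleA; congr (_ * _)%E; rewrite [RHS]muleCA; congr (_ * _)%E;
  exact: muleC.
Qed.
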